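(* Let $\alpha$ be a non-zero algebraic number and suppose $\bar\alpha_1,\ldots,\bar\alpha_N\in V$ satisfy $\pi(\alpha)=\bar\alpha_1\cdots\bar\alpha_N$. Then there exist $\bar\beta_1,\ldots,\bar\beta_N\in V$ with $\pi(\alpha)=\bar\beta_1\cdots\bar\beta_N$ such that $\bar\beta_n\in S(K_\alpha)$ and $\bar M(\bar\beta_n)\le\bar M(\bar\alpha_n)$ for all $n$.
   Context: For a non-zero algebraic number $\gamma$ with minimal polynomial $A\prod_{n=1}^N(x-\gamma_n)$ over $\mathbb Z$ (primitive, $A>0$), $M(\gamma)=A\prod_{n=1}^N\max\{1,|\gamma_n|\}$. $V=\overline{\mathbb Q}^\times/\mathrm{Tor}(\overline{\mathbb Q}^\times)$ (written multiplicatively) with quotient map $\pi$. For $\bar\beta\in V$, $\bar M(\bar\beta)=\inf\{M(\beta):\beta\in\pi^{-1}(\bar\beta)\}$. $K_\alpha$ is the Galois closure of $\mathbb Q(\alpha)$ over $\mathbb Q$. For a number field $K$, $\mathrm{rad}(K)=\{\gamma\in\overline{\mathbb Q}^\times:\gamma^n\in K\text{ for some }n\in\mathbb N\}$ and $S(K)=\pi(\mathrm{rad}(K))$. *)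

(* Defs.v *)
From HB Require Import structures.
From mathcomp Require Import all_boot all_order all_algebra all_field.
From Stdlib Require Import ClassicalEpsilon.
Set Implicit Arguments. Unset Strict Implicit. Unset Printing Implicit Defensive.
Import Order.TTheory GRing.Theory Num.Theory.
Local Open Scope ring_scope.

Definition polyZC (P : {poly int}) : {poly algC} := map_poly (intr : int -> algC) P.

(* P is the minimal polynomial of g over Z: primitive with positive leading
   coefficient (zcontents P = 1), g is a root, and P has least degree among
   non-zero integer polynomials vanishing at g. *)
Definition int_minpoly (g : algC) (P : {poly int}) : Prop :=
  [/\ zcontents P = 1,
      root (polyZC P) g &
      forall Q : {poly int}, Q != 0 -> root (polyZC Q) g -> (size P <= size Q)%N].

Definition is_mahler (g : algC) (m : algC) : Prop :=
  exists P : {poly int}, int_minpoly g P /\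
  exists rs : seq algC,
    polyZC P = (lead_coef P)%:~R *: \prod_(r <- rs) ('X - r%:P) /\
    m = (lead_coef P)%:~R * \prod_(r <- rs) Num.max 1 `|r|.

(* Mahler measure M(g) (well-defined for g <> 0; junk value otherwise). *)
Definition mahler (g : algC) : algC := epsilon (inhabits 0) (is_mahler g).

(* Torsion of algC^x and the quotient map pi: we represent elements of
   V = algC^x / Tor by non-zero representatives, and pi x = pi y iff
   x / y is a root of unity. *)
Definition torsion (z : algC) : Prop := exists n : nat, (0 < n)%N /\ z ^+ n = 1.
Definition same_class (x y : algC) : Prop := x != 0 /\ y != 0 /\ torsion (x / y).

Definition is_inf (S : algC -> Prop) (m : algC) : Prop :=
  (forall x, S x -> m <= x) /\ (forall l, (forall x, S x -> l <= x) -> l <= m).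

Definition Mbar (b : algC) : algC :=
  epsilon (inhabits 0) (is_inf (fun m => exists b', same_class b' b /\ m = mahler b')).

Definition is_subfield (F : algC -> Prop) : Prop :=
  [/\ F 1,
      forall x y, F x -> F y -> F (x - y),
      forall x y, F x -> F y -> F (x * y) &
      forall x, F x -> F x^-1].

Definition galois_closure (a : algC) (x : algC) : Prop :=
  forall F : algC -> Prop, is_subfield F ->
    (forall P c, int_minpoly a P -> root (polyZC P) c -> F c) -> F x.

(* rad(K) and S(K) = pi(rad(K)), membership of a class given by a representative. *)
Definition rad (K : algC -> Prop) (g : algC) : Prop :=
  g != 0 /\ exists n : nat, (0 < n)%N /\ K (g ^+ n).
Definition in_S (K : algC -> Prop) (b : algC) : Prop :=
  exists g, rad K g /\ same_class g b.

(* Main.v *)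
Require Import Defs.
From HB Require Import structures.
From mathcomp Require Import all_boot all_order all_fingroup all_algebra all_field.
From Stdlib Require Import ClassicalEpsilon.
Set Implicit Arguments. Unset Strict Implicit. Unset Printing Implicit Defensive.
Import Order.TTheory GRing.Theory Num.Theory.
Local Open Scope ring_scope.

(** The height M(x)^(1/deg x) is submultiplicative, Galois invariant and
    multiplicative on powers, hence constant on classes modulo torsion; so M is
    least on a class at an element of least degree, and the infimum is attained.
    Let g represent a class with M(g) least, let K be the (normal) closure of
    Q(alpha), and let eta be the product of the d conjugates of g over K.
    A d-th root b of eta has height at most that of g.  As K is normal over Q,
    d * deg eta <= deg g, so deg b <= deg g and M(b) <= M(g).  Up to torsion, b is
    a [K':K]-th root of the norm to K of g, for any Galois K' containing K(g), so
    the b's attached to the factors multiply to alpha up to torsion.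

    The leading coefficients are controlled by integrality: if P is a primitive
    integer polynomial with roots r_i and leading coefficient c, then c times any
    subproduct of the r_i is an algebraic integer, and c divides every algebraic
    integer e with this property, because e / c times each coefficient of P is
    integral. *)

(** * Integrality of leading coefficients *)

Lemma integralOver_Aint (x : algC) : integralOver (intr : int -> algC) x -> x \in Aint.
Proof.
case=> p mon_p px0; apply: root_monic_Aint px0 _ _; first by rewrite monic_map.
by apply/polyOverP=> i; rewrite coef_map /= intr_int.
Qed.

Lemma Aint_integralOver (x : algC) : x \in Aint -> integralOver (intr : int -> algC) x.
Proof.
rewrite unfold_in => /floorpP[p Dp]; exists p; last by rewrite -Dp root_minCpoly.
have := minCpoly_monic x; rewrite Dp !monicE lead_coef_map_inj //; last exact: intr_inj.
by rewrite -(rmorph1 intr) (inj_eq intr_inj).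
Qed.

Lemma Aint_root_monic (p : {poly algC}) x :
  p \is monic -> root p x -> p \is a polyOver Aint -> x \in Aint.
Proof.
move=> mon_p px0 /polyOverP pA; apply/integralOver_Aint.
apply: (integral_root_monic (RtoK := intr) mon_p px0).
by apply/integral_poly => i; apply/Aint_integralOver/pA.
Qed.

Lemma Aint_expr n (x : algC) : (0 < n)%N -> x ^+ n \in Aint -> x \in Aint.
Proof.
move=> n_gt0 xnA; apply: (@Aint_root_monic ('X^n - (x ^+ n)%:P)).
- exact: monicXnsubC.
- by rewrite rootE !hornerE subrr.
- by rewrite rpredB ?polyOverC // rpredX // polyOverX.
Qed.

(** With [a] the leading coefficient and [n.+1] the degree of [g], multiplying [g(r) = 0] by
    [a ^+ n] gives a monic equation for [a * r] with integral coefficients. *)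
Lemma Aint_lead_root (g : {poly algC}) (r : algC) :
  g \is a polyOver Aint -> root g r -> lead_coef g * r \in Aint.
Proof.
move=> gA gr0; have [-> | g0] := eqVneq g 0; first by rewrite lead_coef0 mul0r Aint0.
have sg := root_size_gt1 g0 gr0; set a := lead_coef g.
have aA : a \in Aint by apply: (polyOverP gA).
pose n := (size g).-2; have Dn : size g = n.+2 by rewrite /n; case: (size g) sg => [|[]].
have La : g`_n.+1 = a by rewrite /a /lead_coef Dn.
pose t := \poly_(i < n.+1) (g`_i * a ^+ (n - i)); pose h := 'X^(n.+1) + t.
have szt : (size t < size ('X^(n.+1) : {poly algC}))%N.
  by rewrite size_polyXn ltnS size_poly.
apply: (@Aint_root_monic h).
- by rewrite monicE lead_coefDl // lead_coefXn.
- rewrite rootE /h hornerD hornerXn /t horner_poly.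
  have: a ^+ n * g.[r] = 0 by rewrite (rootP gr0) mulr0.
  rewrite horner_coef Dn big_ord_recr /= La mulrDr mulr_sumr => E.
  rewrite -[X in _ == X]E exprMn addrC exprSr; apply/eqP; congr (_ + _); last first.
    by rewrite mulrA.
  apply: eq_bigr => i _; have le_in : (i <= n)%N by rewrite -ltnS.
  by rewrite exprMn !mulrA; congr (_ * _); rewrite -mulrA -exprD subnK // mulrC.
- rewrite rpredD ?rpredX ?polyOverX //; apply/polyOver_poly => i _.
  by rewrite rpredM ?rpredX // (polyOverP gA).
Qed.

(** Strip the leading term [t] of [q] and induct on the size. The product with ['X - r%:P] has the
    same leading coefficient as [q] and has [r] as a root, so [Aint_lead_root] makes
    [('X - r%:P) * t] integral. *)
Lemma polyOver_Aint_div_XsubC (q : {poly algC}) (r : algC) :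
  ('X - r%:P) * q \is a polyOver Aint -> q \is a polyOver Aint.
Proof.
have [n] := ubnP (size q); elim: n q => // n IHn q /ltnSE-sq qA.
have [-> | q0] := eqVneq q 0; first exact: rpred0.
have lA : lead_coef q \in Aint.
  have: lead_coef (('X - r%:P) * q) \in Aint by apply: (polyOverP qA).
  by rewrite lead_coefM lead_coefXsubC mul1r.
have lrA : lead_coef q * r \in Aint.
  rewrite -[lead_coef q]mul1r -(lead_coefXsubC r) -lead_coefM.
  by apply: Aint_lead_root => //; rewrite rootM root_XsubC eqxx.
pose t := lead_coef q *: 'X^((size q).-1).
have tA : ('X - r%:P) * t \is a polyOver Aint.
  rewrite mulrBl rpredB // /t; first by rewrite rpredM ?polyOverX ?polyOverZ ?rpredX ?polyOverX.
  by rewrite -scalerAr mul_polyC scalerA polyOverZ ?rpredX ?polyOverX.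
rewrite -[q](subrK t) rpredD //; last by rewrite polyOverZ ?rpredX ?polyOverX.
apply: IHn; last by rewrite mulrBr rpredB.
have sq0 : (0 < size q)%N by rewrite size_poly_gt0.
apply: leq_trans sq; rewrite -(prednK sq0) ltnS; apply/leq_sizeP => j lej.
rewrite coefB coefZ coefXn; have [->|ne] := eqVneq j (size q).-1.
  by rewrite mulr1 -lead_coefE subrr.
rewrite mulr0 subr0 nth_default // -(prednK sq0) ltn_neqAle eq_sym ne //.
Qed.

(** Masks run over the subproducts of roots. Skipping a root [x] divides by ['X - x%:P]. Keeping it
    replaces [c] by [c * x], and [(c * x) q = X (c q) - c (X - x) q] preserves integrality. *)
Lemma Aint_scale_prod_mask (c : algC) s m :
  c *: \prod_(r <- s) ('X - r%:P) \is a polyOver Aint ->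
  c * \prod_(r <- mask m s) r \in Aint.
Proof.
elim: s c m => [|x s IHs] c m cA.
  by move: cA; rewrite mask0 !big_nil mulr1 alg_polyC polyOverC.
have sA: c *: \prod_(r <- s) ('X - r%:P) \is a polyOver Aint.
  by apply: (@polyOver_Aint_div_XsubC _ x); rewrite -scalerAr; rewrite big_cons in cA.
case: m => [|[] m] /=; last exact: IHs.
  by move: (IHs _ [::] sA); rewrite mask0s.
rewrite big_cons mulrA; apply: IHs.
have ->: (c * x) *: \prod_(r <- s) ('X - r%:P) =
  'X * (c *: \prod_(r <- s) ('X - r%:P)) - c *: \prod_(r <- x :: s) ('X - r%:P).
  rewrite big_cons scalerAr -mulrBl opprB addrC subrK mul_polyC scalerA mulrC //.
by rewrite rpredB // rpredM ?polyOverX.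
Qed.

Lemma polyOver_Aint_scale_prod (c : algC) s :
  (forall m, c * \prod_(r <- mask m s) r \in Aint) ->
  c *: \prod_(r <- s) ('X - r%:P) \is a polyOver Aint.
Proof.
elim: s c => [|x s IHs] c cA.
  by have := cA [::]; rewrite !big_nil mulr1 alg_polyC polyOverC.
rewrite big_cons scalerAr mulrBl mul_polyC scalerA mulrC [x * c]mulrC.
rewrite rpredB //; first rewrite rpredM ?polyOverX //.
  by apply: IHs => m; have := cA (false :: m).
by apply: IHs => m; have := cA (true :: m); rewrite /= big_cons mulrA.
Qed.

(** Up to sign the content is the gcd of the coefficients, hence by Bezout an integer combination of
    them. *)
Lemma Aint_mul_zcontents (x : algC) (P : {poly int}) :
  (forall i, x * (P`_i)%:~R \in Aint) -> x * (zcontents P)%:~R \in Aint.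
Proof.
move=> xA; rewrite /zcontents intrM mulrCA rpredM ?Aint_int //.
apply: (big_ind (fun n : nat => x * (n%:Z)%:~R \in Aint)).
- by rewrite mulr0z mulr0 Aint0.
- move=> m n mA nA; have [u [v E]] := Bezoutz m n.
  have ->: (gcdn m n)%:Z = u * m%:Z + v * n%:Z by rewrite E.
  by rewrite intrD mulrDr !intrM ![x * _]mulrCA rpredD // rpredM ?Aint_int.
- by move=> i _; rewrite abszEsg intrM mulrCA rpredM ?Aint_int.
Qed.

(** * Mahler measures of lists of roots *)

(** [P] may be reducible: [s] can then repeat each conjugate, as it does when indexed by a whole
    Galois group. *)
Definition primitive_split (s : seq algC) (P : {poly int}) : Prop :=
  zcontents P = 1 /\
  polyZC P = (lead_coef P)%:~R *: \prod_(r <- s) ('X - r%:P).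

Definition mahler_of_roots (s : seq algC) (m : algC) : Prop :=
  exists2 P, primitive_split s P &
    m = (lead_coef P)%:~R * \prod_(r <- s) Num.max 1 `|r|.

Lemma zcontents1_lead_gt0 (P : {poly int}) : zcontents P = 1 -> 0 < lead_coef P.
Proof. by move=> cP; rewrite -sgz_gt0 -sgz_contents cP. Qed.

Lemma primitive_split_Aint s P m : primitive_split s P ->
  (lead_coef P)%:~R * \prod_(r <- mask m s) r \in Aint.
Proof.
case=> _ DP; apply: Aint_scale_prod_mask; rewrite -DP.
by apply/polyOverP=> i; rewrite coef_map Aint_int.
Qed.

Lemma primitive_split_div_Aint s P e : primitive_split s P ->
  (forall m, e * \prod_(r <- mask m s) r \in Aint) ->
  e / (lead_coef P)%:~R \in Aint.
Proof.
case=> cP DP /polyOver_Aint_scale_prod/polyOverP eA.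
have nz : (lead_coef P)%:~R != 0 :> algC by rewrite intr_eq0 gt_eqF ?zcontents1_lead_gt0.
suff: e / (lead_coef P)%:~R * (zcontents P)%:~R \in Aint by rewrite cP mulr1.
apply: Aint_mul_zcontents => i.
have := congr1 (fun p : {poly algC} => p`_i) DP; rewrite coef_map coefZ /= => ->.
by rewrite mulrA divfK // -coefZ.
Qed.

Lemma intr_div_Aint_le (c d : int) :
  0 < c -> 0 < d -> c%:~R / d%:~R \in Aint -> d <= c.
Proof.
move=> c0 d0 cdA.
have /intrP[k Dk]: (c%:~R / d%:~R : algC) \in Num.int.
  by apply: Cint_rat_Aint cdA; rewrite rpred_div // rpred_int.
have nz : d%:~R != 0 :> algC by rewrite intr_eq0 gt_eqF.
have Dc : c = k * d.
  by apply: (@intr_inj algC); rewrite intrM -Dk divfK.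
by rewrite Dc ler_peMl ?(ltW d0) // -gtz0_ge1 -(pmulr_lgt0 _ d0) -Dc.
Qed.

Lemma prod_mask_map (T : Type) (r : seq T) (f : T -> algC) m :
  \prod_(x <- mask m (map f r)) x = \prod_(t <- mask m r) f t.
Proof. by rewrite -map_mask big_map. Qed.

(** Each subproduct of the [f t * g t] is a subproduct of the [f t] times one of the [g t], so
    [lead_coef R] divides [lead_coef P * lead_coef Q]. *)
Lemma primitive_split_prod_le (T : Type) (r : seq T) (f g : T -> algC) P Q R :
  primitive_split (map f r) P -> primitive_split (map g r) Q ->
  primitive_split (map (fun t => f t * g t) r) R ->
  lead_coef R <= lead_coef P * lead_coef Q.
Proof.
move=> HP HQ HR; have [[[cP _] [cQ _]] [cR _]] := (HP, HQ, HR).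
apply: intr_div_Aint_le; rewrite ?mulr_gt0 ?zcontents1_lead_gt0 //.
apply: (primitive_split_div_Aint HR) => m.
rewrite intrM prod_mask_map big_split /= mulrACA -(prod_mask_map _ f) -(prod_mask_map _ g).
by rewrite rpredM ?primitive_split_Aint.
Qed.

(* The upper bound for [lead_coef P] uses the k-th root of [lead_coef Q], an
   algebraic integer whose product with any subproduct of the roots is integral. *)
Lemma primitive_split_exp (T : Type) (r : seq T) (f : T -> algC) k P Q :
  (0 < k)%N -> primitive_split (map f r) P ->
  primitive_split (map (fun t => f t ^+ k) r) Q ->
  lead_coef Q = lead_coef P ^+ k.
Proof.
move=> k0 HP HQ; have [[cP _] [cQ _]] := (HP, HQ).
have P0 := zcontents1_lead_gt0 cP; have Q0 := zcontents1_lead_gt0 cQ.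
apply/le_anti/andP; split; apply: intr_div_Aint_le; rewrite ?exprn_gt0 //.
  apply: (primitive_split_div_Aint HQ) => m.
  rewrite rmorphXn prod_mask_map prodrXl -exprMn -(prod_mask_map _ f).
  by rewrite rpredX ?primitive_split_Aint.
pose e := k.-root ((lead_coef Q)%:~R : algC).
have De : e ^+ k = (lead_coef Q)%:~R by rewrite rootCK.
rewrite rmorphXn -De -exprVn -exprMn rpredX //.
apply: (primitive_split_div_Aint HP) => m; apply: (Aint_expr k0).
rewrite exprMn De prod_mask_map -prodrXl -(prod_mask_map _ (fun t => f t ^+ k)).
exact: primitive_split_Aint.
Qed.

Lemma max1_ge1 (x : algC) : 1 <= Num.max 1 `|x|.
Proof. by rewrite comparable_le_max ?lexx // real_comparable ?normr_real. Qed.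

Lemma max1_expr (x : algC) k : Num.max 1 `|x ^+ k| = Num.max 1 `|x| ^+ k.
Proof.
rewrite normrX; have [le1|lt1] := real_leP (@real1 algC) (normr_real x).
  by rewrite max_r // exprn_ege1.
by rewrite max_l ?expr1n // exprn_ile1 // ltW.
Qed.

Lemma max1M_le (x y : algC) :
  Num.max 1 `|x * y| <= Num.max 1 `|x| * Num.max 1 `|y|.
Proof.
rewrite comparable_ge_max ?real_comparable ?normr_real ?real1 //.
rewrite mulr_ege1 ?max1_ge1 //= normrM ler_pM //.
all: by rewrite comparable_le_max ?lexx ?orbT // real_comparable ?normr_real.
Qed.

Lemma mahler_of_roots_ge1 s m : mahler_of_roots s m -> 1 <= m.
Proof.
case=> P [cP _] ->; apply: mulr_ege1; first by rewrite ler1z -gtz0_ge1 zcontents1_lead_gt0.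
by apply: (big_ind (fun x => 1 <= x)) => // [x y|r _]; [apply: mulr_ege1 | apply: max1_ge1].
Qed.

Lemma mahler_of_roots_prod_le (T : Type) (r : seq T) (f g : T -> algC) a b c :
  mahler_of_roots (map f r) a -> mahler_of_roots (map g r) b ->
  mahler_of_roots (map (fun t => f t * g t) r) c -> c <= a * b.
Proof.
case=> [P HP ->] [Q HQ ->] [R HR ->]; rewrite !big_map mulrACA -intrM -big_split /=.
have [[[cP _] [cQ _]] [cR _]] := (HP, HQ, HR).
apply: ler_pM.
- by rewrite ler0z ltW ?zcontents1_lead_gt0.
- by apply: prodr_ge0 => t _; apply: le_trans (max1_ge1 _).
- by rewrite ler_int (primitive_split_prod_le HP HQ HR).
apply: ler_prod => t _; rewrite max1M_le andbT; exact: le_trans (max1_ge1 _).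
Qed.

Lemma mahler_of_roots_exp (T : Type) (r : seq T) (f : T -> algC) k a b :
  (0 < k)%N -> mahler_of_roots (map f r) a ->
  mahler_of_roots (map (fun t => f t ^+ k) r) b -> b = a ^+ k.
Proof.
move=> k0 [P HP ->] [Q HQ ->].
rewrite (primitive_split_exp k0 HP HQ) rmorphXn exprMn !big_map -prodrXl.
by congr (_ * _); apply: eq_bigr => t _; rewrite max1_expr.
Qed.

Lemma mahler_of_roots_perm s t m :
  perm_eq s t -> mahler_of_roots s m -> mahler_of_roots t m.
Proof.
move=> st [P [cP DP] ->]; exists P; last by rewrite (perm_big _ st).
by split=> //; rewrite DP (perm_big _ st).
Qed.

Lemma mahler_of_roots_uniq s a b :
  mahler_of_roots s a -> mahler_of_roots s b -> a = b.
Proof.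
move=> Ha Hb; apply/esym; rewrite -[a]expr1.
apply: (@mahler_of_roots_exp _ s id 1) => //; first by rewrite map_id.
by rewrite (eq_map (fun t => expr1 t)) map_id.
Qed.

Lemma mahler_of_roots_nil : mahler_of_roots [::] 1.
Proof.
exists 1; last by rewrite lead_coef1 big_nil mulr1.
by split; rewrite ?zcontents_monic ?monic1 // /polyZC rmorph1 lead_coef1 big_nil scale1r.
Qed.

Lemma mahler_of_roots_cat s t a b :
  mahler_of_roots s a -> mahler_of_roots t b -> mahler_of_roots (s ++ t) (a * b).
Proof.
case=> [P [cP DP] ->] [Q [cQ DQ] ->]; exists (P * Q).
  split; first by rewrite zcontentsM cP cQ mulr1.
  rewrite /polyZC rmorphM /= -!/(polyZC _) DP DQ lead_coefM intrM big_cat /=.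
  by rewrite -scalerAl -scalerAr scalerA.
by rewrite lead_coefM intrM big_cat /= mulrACA.
Qed.

Lemma mahler_of_roots_nseq s a k :
  mahler_of_roots s a -> mahler_of_roots (flatten (nseq k s)) (a ^+ k).
Proof.
move=> sa; elim: k => [|k IHk] /=; first exact: mahler_of_roots_nil.
by rewrite exprS; apply: mahler_of_roots_cat.
Qed.

(** * Integer minimal polynomials and the measure of an algebraic number *)

Lemma polyZC_ratr (P : {poly int}) :
  polyZC P = map_poly ratr (map_poly (intr : int -> rat) P).
Proof. by rewrite -map_poly_comp; apply: eq_map_poly => b; rewrite /= ratr_int. Qed.

(** Clear denominators in the rational minimal polynomial and take the primitive part. Least degree
    holds because the rational minimal polynomial divides every rational polynomial vanishing at
    [x]. *)
Lemma int_minpoly_minCpoly x :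
  exists2 P, int_minpoly x P & polyZC P = (lead_coef P)%:~R *: minCpoly x.
Proof.
have [p [Dp mp] dvp] := minCpolyP x.
have [q [a a0 Dq]] := rat_poly_scale p.
have q0 : q != 0.
  apply: contraTneq mp => q0; rewrite Dq q0 rmorph0 scaler0 monicE lead_coef0.
  by rewrite eq_sym oner_eq0.
pose P := zprimitive q.
have Pp : map_poly (intr : int -> rat) P = (lead_coef P)%:~R *: p.
  have Dq' : map_poly (intr : int -> rat) q = (zcontents q)%:~R *: map_poly intr P.
    by rewrite [in LHS](zpolyEprim q) map_polyZ.
  have E : map_poly (intr : int -> rat) P = ((zcontents q)%:~R^-1 * a%:~R) *: p.
    by rewrite Dq Dq' !scalerA mulfK ?intr_eq0 // mulVf ?intr_eq0 ?zcontents_eq0 // scale1r.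
  have := congr1 lead_coef E; rewrite lead_coefZ (monicP mp) mulr1.
  by rewrite lead_coef_map_inj ?rmorph0 //; [rewrite E => -> | apply: intr_inj].
have PC : polyZC P = (lead_coef P)%:~R *: minCpoly x.
  by rewrite polyZC_ratr Pp Dp map_polyZ /= ratr_int.
exists P => //; split; first by rewrite zcontents_primitive q0.
  by rewrite PC rootZ ?root_minCpoly // intr_eq0 lead_coef_eq0 zprimitive_eq0.
move=> R R0; rewrite polyZC_ratr dvp => /dvdp_leq.
rewrite size_map_inj_poly ?rmorph0 //; last exact: intr_inj.
rewrite Dq size_scale ?invr_eq0 ?intr_eq0 // size_map_inj_poly ?rmorph0 //; last exact: intr_inj.
by rewrite size_zprimitive; apply; rewrite map_poly_eq0_id0 // intr_eq0 lead_coef_eq0.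
Qed.

Lemma int_minpoly_eq x P : int_minpoly x P -> polyZC P = (lead_coef P)%:~R *: minCpoly x.
Proof.
have [Q [cQ rQ minQ] DQ] := int_minpoly_minCpoly x; case=> cP rP minP.
have nz R : zcontents R = 1 -> R != 0 by move=> cR; rewrite -zcontents_eq0 cR.
have szZ R : size (polyZC R) = size R.
  by rewrite size_map_inj_poly ?rmorph0 //; apply: intr_inj.
have dvP : minCpoly x %| polyZC P.
  have [p [-> _] dvp] := minCpolyP x.
  by rewrite polyZC_ratr dvdp_map -dvp -polyZC_ratr.
have szP : size (minCpoly x) == size (polyZC P).
  have := szZ Q; rewrite DQ size_scale ?intr_eq0 ?lead_coef_eq0 ?nz // => ->.
  by rewrite szZ eqn_leq minQ ?minP ?nz.
have /eqpf_eq[c c0 Dc] : minCpoly x %= polyZC P by rewrite -dvdp_size_eqp.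
have LP : lead_coef (polyZC P) = (lead_coef P)%:~R.
  by rewrite lead_coef_map_inj //; apply: intr_inj.
rewrite -LP; have /monicP := minCpoly_monic x; rewrite Dc lead_coefZ => E.
by rewrite scalerA mulrC E scale1r.
Qed.

(** Existence of the integer minimal polynomial makes the [epsilon] in [mahler] meaningful; later
    arguments use [mahler] only through this form. *)
Lemma mahler_spec x : exists rs : seq algC,
  minCpoly x = \prod_(r <- rs) ('X - r%:P) /\ mahler_of_roots rs (mahler x).
Proof.
have: is_mahler x (mahler x).
  apply: epsilon_spec; have [P mP DP] := int_minpoly_minCpoly x.
  have [rs Drs] := closed_field_poly_normal (minCpoly x).
  exists ((lead_coef P)%:~R * \prod_(r <- rs) Num.max 1 `|r|), P; split=> //.
  exists rs; split=> //.
  by rewrite DP [in LHS]Drs (monicP (minCpoly_monic x)) scale1r.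
case=> P [mP [rs [DP ->]]]; have DP' := int_minpoly_eq mP; case: mP => cP _ _.
exists rs; split; last by exists P.
apply: (@scalerI _ _ (lead_coef P)%:~R); last by rewrite -DP -DP'.
by rewrite intr_eq0 gt_eqF ?zcontents1_lead_gt0.
Qed.

Lemma mahler_ge1 x : 1 <= mahler x.
Proof. by have [rs [_ /mahler_of_roots_ge1]] := mahler_spec x. Qed.

Lemma minCpoly_int_minpoly_root x c :
  root (minCpoly x) c -> exists P, int_minpoly x P /\ root (polyZC P) c.
Proof.
have [P mP DP] := int_minpoly_minCpoly x => rc; exists P; split=> //.
by rewrite DP rootE hornerZ (rootP rc) mulr0.
Qed.

(** * Galois orbits *)

(** The roots of the product of the minimal polynomials of the entries generate a number field in
    which this rational polynomial splits, so Galois theory applies there. *)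
Lemma splitting_num_field (s : seq algC) :
  exists (L : splittingFieldType rat) (iota : {rmorphism L -> algC}),
    forall x, x \in s -> exists y : L, iota y = x.
Proof.
pose p := \prod_(x <- s) minCpoly x.
have [t Dt] := closed_field_poly_normal p.
have mp : p \is monic by apply: monic_prod => x _; apply: minCpoly_monic.
rewrite (monicP mp) scale1r in Dt.
have [p0 Dp0] : exists p0 : {poly rat}, p = map_poly ratr p0.
  rewrite /p; elim: s {p t Dt mp} => [|x s [q Dq]].
    by exists 1; rewrite big_nil rmorph1.
  have [q' [Dq' _] _] := minCpolyP x; exists (q' * q).
  by rewrite big_cons Dq Dq' rmorphM.
have [Q [iota [t1 Dt1 genQ]]] := num_field_exists t.
have split_p : map_poly (in_alg Q) p0 = \prod_(y <- t1) ('X - y%:P).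
  apply: (map_poly_inj iota); rewrite -map_poly_comp.
  rewrite (eq_map_poly (g := ratr)); last by move=> a /=; rewrite alg_num_field fmorph_rat.
  rewrite -Dp0 Dt -Dt1 big_map rmorph_prod; apply: eq_bigr => y _.
  by rewrite /= rmorphB /= map_polyX map_polyC.
have spl : splitting_field_axiom Q.
  exists (map_poly (in_alg Q) p0); first exact: alg_polyOver.
  by exists t1 => //; rewrite split_p eqpxx.
pose mixin := FieldExt_isSplittingField.Build rat Q spl.
pose L : splittingFieldType rat := HB.pack Q mixin.
exists L, iota => x sx.
have: x \in t.
  by rewrite -root_prod_XsubC -Dt /p (big_rem x sx) /= rootM root_minCpoly.
by rewrite -Dt1 => /mapP[y _ ->]; exists y.
Qed.

Section GaloisOrbit.

Variables (L : splittingFieldType rat) (K : {subfield L}) (a : L).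

Local Notation G := 'Gal({:L} / K)%G.
Local Notation S := 'Gal({:L} / <<K; a>>)%G.

Lemma galois_full : galois K {:L}.
Proof.
rewrite /galois subvf normalFieldf andbT; apply/separableP => y _.
by apply: pcharf0_separable => p; rewrite pchar_lalg pchar_num.
Qed.

Lemma mem_gal_adjoin s : (s \in S) = (s \in G) && (s a == a).
Proof.
rewrite !gal_kHom ?subvf //.
apply/kAHomP/andP => [H | [/kAHomP HK /eqP Ha] y].
  split; last by rewrite H ?memv_adjoin.
  by apply/kAHomP => y Ky; apply: H; apply: subvP_adjoin.
case/Fadjoin_polyP => p /polyOverP pK ->; rewrite -horner_map /= Ha.
by congr _.[_]; apply/polyP => i; rewrite coef_map /= HK.
Qed.

(** The automorphisms agreeing with [s] at [a] form the right coset of the stabilizer [S] through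
    [s]. *)
Lemma card_gal_image s : s \in G -> #|[set t in G | t a == s a]| = #|S|.
Proof.
move=> Gs; rewrite -(card_rcoset S s); apply: eq_card => t.
rewrite inE mem_rcoset mem_gal_adjoin groupMr ?groupV //; congr (_ && _).
rewrite galM ?memvf //.
apply/eqP/eqP => [-> | E]; first by rewrite -galM ?memvf // mulgV gal_id.
by rewrite -{2}E -galM ?memvf // mulVg gal_id.
Qed.

(** Compare multiplicities: a conjugate of [a] is hit by one coset of [S], any other value by
    nothing. *)
Lemma gal_orbit : exists r : seq L,
  minPoly K a = \prod_(b <- r) ('X - b%:P) /\
  perm_eq [seq (s : gal_of {:L}) a | s <- enum G] (flatten (nseq #|S| r)).
Proof.
have /(galois_factors (subvf K))/(_ a (memvf a))[r [/subsetP rG Ur Dr]] := galois_full.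
exists [seq (s : gal_of {:L}) a | s <- r]; split=> //.
set ra := map _ r in Ur Dr *.
apply/allP => y _ /=; rewrite count_map -size_filter.
have Eflat k : count_mem y (flatten (nseq k ra)) = (k * (y \in ra))%N.
  by elim: k => //= k IHk; rewrite count_cat IHk count_uniq_mem.
rewrite Eflat; apply/eqP.
have Ecnt : size [seq t <- enum G | preim (fun s : gal_of {:L} => s a) (pred1 y) t]
          = #|[set t in G | (t : gal_of _) a == y]|.
  rewrite cardE /enum_mem; congr size; rewrite -filter_predI.
  by apply: eq_filter => t; rewrite !inE andbC.
rewrite Ecnt; have [/mapP[s rs ->] | y_ra] := boolP (y \in ra).
  by rewrite muln1 card_gal_image ?rG.
rewrite muln0; apply: eq_card0 => t; rewrite !inE; apply/negP=> /andP[Gt /eqP Et].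
case/negP: y_ra; rewrite -root_prod_XsubC -Dr -Et.
by apply: root_minPoly_gal; rewrite ?subvf ?memvf.
Qed.

Lemma card_gal_adjoin : (#|G| = #|S| * (size (minPoly K a)).-1)%N.
Proof.
have [r [-> /perm_size]] := gal_orbit.
rewrite size_map -cardE size_flatten /shape map_nseq sumn_nseq size_prod_XsubC => ->.
by rewrite mulnC.
Qed.

End GaloisOrbit.

(** Both polynomials are monic with rational coefficients, and each divides the other by
    minimality. *)
Lemma minCpoly_minPoly (L : fieldExtType rat) (iota : {rmorphism L -> algC}) y :
  minCpoly (iota y) = map_poly iota (minPoly 1 y).
Proof.
have E q : map_poly iota (map_poly (in_alg L) q) = map_poly ratr q.
  by rewrite -map_poly_comp; apply: eq_map_poly => a; rewrite /= alg_num_field fmorph_rat.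
have [p [Dp mp] dvp] := minCpolyP (iota y).
rewrite Dp -E; congr map_poly; apply/eqP.
rewrite -eqp_monic ?monic_map ?monic_minPoly // /eqp; apply/andP; split.
  have /polyOver1P[q Dq] := minPolyOver 1 y; rewrite Dq dvdp_map -dvp -E -Dq.
  by rewrite fmorph_root root_minPoly.
apply: minPoly_dvdp; first exact: alg_polyOver.
by rewrite -(fmorph_root iota) E -Dp root_minCpoly.
Qed.

Definition algC_degree (x : algC) : nat := (size (minCpoly x)).-1.

Lemma algC_degree_gt0 x : (0 < algC_degree x)%N.
Proof. by rewrite /algC_degree -ltnS prednK ?size_minCpoly // ltnW ?size_minCpoly. Qed.

Lemma mahler_minCpoly x y : minCpoly x = minCpoly y -> mahler x = mahler y.
Proof.
have [[r [-> Hr]] [t [-> Ht]]] := (mahler_spec x, mahler_spec y).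
move/prod_XsubC_eq/mahler_of_roots_perm/(_ Hr) => Hr'.
exact: mahler_of_roots_uniq Hr' Ht.
Qed.

(** * Measures of families indexed by a Galois group *)

Section MahlerSplitting.

Variables (L : splittingFieldType rat) (iota : {rmorphism L -> algC}).

Local Notation G := 'Gal({:L} / 1%AS)%G.
Local Notation stab y := 'Gal({:L} / <<1%AS; y>>)%G.

Lemma card_gal_degree y : #|G| = (#|stab y| * algC_degree (iota y))%N.
Proof. by rewrite (card_gal_adjoin 1%AS y) /algC_degree minCpoly_minPoly size_map_poly. Qed.

(** Indexing by all of [G] lets elements of different degrees share one index list. As [#|stab y|]
    is [#|G|] over the degree, the measure obtained is the height of [iota y] to the power
    [#|G|]. *)
Lemma mahler_gal y :
  mahler_of_roots [seq iota ((s : gal_of {:L}) y) | s <- enum G]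
    (mahler (iota y) ^+ #|stab y|).
Proof.
have [rs [Drs Hrs]] := mahler_spec (iota y).
have [r [Dr Pr]] := gal_orbit 1%AS y.
rewrite (map_comp iota (fun s : gal_of {:L} => s y)).
have rsr : perm_eq rs (map iota r).
  apply: prod_XsubC_eq; rewrite -Drs minCpoly_minPoly Dr rmorph_prod big_map.
  by apply: eq_bigr => b _; rewrite /= map_polyXsubC.
apply: mahler_of_roots_perm (mahler_of_roots_nseq _ (mahler_of_roots_perm rsr Hrs)).
by rewrite perm_sym -map_nseq -map_flatten perm_map.
Qed.

Lemma mahler_gal_mul_le x y :
  mahler (iota (x * y)) ^+ #|stab (x * y)| <=
  mahler (iota x) ^+ #|stab x| * mahler (iota y) ^+ #|stab y|.
Proof.
apply: (mahler_of_roots_prod_le (mahler_gal x) (mahler_gal y)).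
rewrite (@eq_map _ _ _ (fun s : gal_of {:L} => iota (s (x * y)))); first exact: mahler_gal.
by move=> s; rewrite -!rmorphM.
Qed.

Lemma mahler_gal_exp x k : (0 < k)%N ->
  mahler (iota (x ^+ k)) ^+ #|stab (x ^+ k)| = mahler (iota x) ^+ (#|stab x| * k).
Proof.
move=> k0; rewrite exprM; apply: (mahler_of_roots_exp k0 (mahler_gal x)).
rewrite (@eq_map _ _ _ (fun s : gal_of {:L} => iota (s (x ^+ k)))); first exact: mahler_gal.
by move=> s; rewrite -!rmorphXn.
Qed.

Lemma mahler_gal_prod_le y r :
  {in r, forall b, minCpoly (iota b) = minCpoly (iota y)} ->
  mahler (iota (\prod_(b <- r) b)) ^+ #|stab (\prod_(b <- r) b)| <=
  mahler (iota y) ^+ (#|stab y| * size r).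
Proof.
elim: r => [_|b r IHr Hr].
  (* For the empty product, the power law applied to [1 ^+ 2 = 1] gives [m = m ^+ 2], and [m >= 1]
     forces [m = 1]. *)
  rewrite big_nil muln0 expr0; have := @mahler_gal_exp 1 2 isT; rewrite expr1n exprM.
  set m := _ ^+ _ => Dm; have m1 : 1 <= m by rewrite exprn_ege1 ?mahler_ge1.
  have m0 : m != 0 by rewrite gt_eqF // (lt_le_trans ltr01).
  by suff ->: m = 1 by []; apply: (mulfI m0); rewrite mulr1 -expr2.
have Eb := Hr b (mem_head _ _).
have Estab : #|stab b| = #|stab y|.
  apply/eqP; rewrite -(eqn_pmul2r (algC_degree_gt0 (iota y))) -card_gal_degree.
  by rewrite {1}/algC_degree -Eb -/(algC_degree _) -card_gal_degree.
rewrite big_cons; apply: le_trans (mahler_gal_mul_le _ _) _.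
rewrite /= mulnS exprD (mahler_minCpoly Eb) Estab.
rewrite ler_wpM2l ?exprn_ge0 ?(le_trans ler01) ?mahler_ge1 //.
by apply: IHr => c rc; apply: Hr; rewrite inE rc orbT.
Qed.

End MahlerSplitting.

Lemma mahler_ge0 x : 0 <= mahler x.
Proof. exact: le_trans ler01 (mahler_ge1 x). Qed.

(* This is M(x^k)^(1 / deg (x^k)) = M(x)^(k / deg x), with the exponents cleared. *)
Lemma mahler_exp x k : (0 < k)%N ->
  mahler (x ^+ k) ^+ algC_degree x = mahler x ^+ (k * algC_degree (x ^+ k)).
Proof.
move=> k0; have [L [iota /(_ x (mem_head _ [::]))[y <-]]] := splitting_num_field [:: x].
have H := mahler_gal_exp iota y k0.
have Gx := card_gal_degree iota y; have Gxk := card_gal_degree iota (y ^+ k).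
rewrite -rmorphXn; apply: (@pexpIrn _ #|'Gal({:L} / 1%AS)%G|);
  rewrite ?cardG_gt0 ?nnegrE ?exprn_ge0 ?mahler_ge0 //.
rewrite -exprM {1}Gxk mulnCA exprM H -!exprM Gx; congr (_ ^+ _).
by rewrite [RHS]mulnC mulnACA.
Qed.

(** If [q] is the rational minimal polynomial of [x ^+ k], then [x] is a root of the non-zero
    polynomial [q \Po 'X^k]. *)
Lemma algC_degree_root_le x k : (0 < k)%N ->
  (algC_degree x <= k * algC_degree (x ^+ k))%N.
Proof.
move=> k0; rewrite /algC_degree.
have [[p [Dp mp] dvp] [q [Dq mq] _]] := (minCpolyP x, minCpolyP (x ^+ k)).
have: root (map_poly ratr (q \Po 'X^k)) x.
  by rewrite map_comp_poly map_polyXn rootE horner_comp hornerXn -Dq (rootP (root_minCpoly _)).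
have nz : q \Po 'X^k != 0.
  apply: contraTneq isT => E; have := size_comp_poly q 'X^k; rewrite E size_poly0 size_polyXn.
  have := size_minCpoly (x ^+ k); rewrite Dq size_map_poly /=.
  by case: (size q) => [|[|n]] //= _; case: (k) k0 => // k' _; rewrite mulSn addSn.
rewrite dvp => /(dvdp_leq nz) le_pq; rewrite Dp Dq !size_map_poly.
have := size_comp_poly q 'X^k; rewrite size_polyXn /= mulnC => <-.
by rewrite -!subn1 leq_sub2r.
Qed.

(** * Products of conjugates and the Galois closure *)

Lemma prod_roots_coef0 (F : fieldType) (p : {poly F}) (r : seq F) :
  p = \prod_(b <- r) ('X - b%:P) -> \prod_(b <- r) b = (-1) ^+ size r * p`_0.
Proof.
by move=> ->; rewrite coef0_prod_XsubC mulrA -exprD addnn -mul2n exprM sqrrN !expr1n mul1r.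
Qed.

Lemma prod_conj_mem (F : fieldType) (L : fieldExtType F) (K : {subfield L}) y (r : seq L) :
  minPoly K y = \prod_(b <- r) ('X - b%:P) -> \prod_(b <- r) b \in K.
Proof.
move=> /prod_roots_coef0 ->.
by rewrite rpredM ?rpredX ?rpredN ?mem1v // (polyOverP (minPolyOver K y)).
Qed.

(* K is normal over Q, so Gal(L/K) and Gal(L/Q(y)) both fix the product of the
   K-conjugates of y; hence so does their product set, whose order is computed
   from that of their intersection Gal(L/K(y)). *)
Lemma degree_conj_prod (L : splittingFieldType rat) (K : {subfield L}) (y : L) (r : seq L) :
  normalField 1 K -> minPoly K y = \prod_(b <- r) ('X - b%:P) ->
  (size r * (size (minPoly 1 (\prod_(b <- r) b))).-1 <= (size (minPoly 1 y)).-1)%N.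
Proof.
move=> nK Dr; set eta := \prod_(b <- r) b.
have Deta : eta = (-1) ^+ size r * (minPoly K y)`_0 := prod_roots_coef0 Dr.
pose S := 'Gal({:L} / <<1%AS; y>>)%G; pose T := 'Gal({:L} / <<1%AS; eta>>)%G.
pose H := 'Gal({:L} / K)%G; pose U := 'Gal({:L} / <<K; y>>)%G.
have HT : H \subset T.
  apply: galS; apply/FadjoinP; split; [exact: sub1v | exact: prod_conj_mem Dr].
have ST : S \subset T.
  apply/subsetP => s; rewrite !mem_gal_adjoin => /andP[Gs /eqP sy]; rewrite Gs /=.
  (* Normality gives [s(K) = K]. As [s] also fixes [y], it fixes the minimal polynomial of [y] over
     [K], whose constant term is [eta] up to sign. *)
  have sK : (s @: K)%VS = K.
    apply/eqP; have /forall_inP/(_ (gal_repr s)) := nK; apply.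
    by move: Gs; rewrite !inE gal_kAut ?sub1v.
  have Ds : map_poly s (minPoly K y) = minPoly K y.
    by rewrite (map_minPoly s) /= sy sK.
  rewrite Deta rmorphM rmorphXn rmorphN rmorph1 /=; apply/eqP; congr (_ * _).
  by rewrite -{2}Ds coef_map.
have HSU : H :&: S \subset U.
  by apply/subsetP => s; rewrite inE !mem_gal_adjoin => /andP[-> /andP[_ ->]].
have HST : (#|(H * S)%g| <= #|T|)%N by rewrite subset_leq_card // mul_subG.
have GS : _ = (#|S| * _)%N := card_gal_adjoin 1%AS y.
have GT : _ = (#|T| * _)%N := card_gal_adjoin 1%AS eta.
have HU : #|H| = (#|U| * _)%N := card_gal_adjoin K y.
rewrite Dr size_prod_XsubC /= in HU.
(* Multiplied by [#|U|], the left side is [#|H| * #|S| = #|H * S| * #|H :&: S|], which is at most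
   [#|T| * #|U|]. *)
have dS_le : (size r * #|S| <= #|T|)%N.
  rewrite -(leq_pmul2l (cardG_gt0 U)) mulnA -[(_ * size r)%N]HU (mul_cardG H S) mulnC.
  by apply: leq_mul => //; apply: subset_leq_card.
rewrite -(leq_pmul2l (cardG_gt0 S)) -GS GT mulnA leq_mul2r mulnC dS_le orbT //.
Qed.

(** Adjoin the conjugates one at a time: each new element is a polynomial in the last conjugate over
    the previous field, so its image lies in every subfield of [algC] containing the conjugates. *)
Lemma galois_closure_adjoin (L : splittingFieldType rat) (iota : {rmorphism L -> algC})
    (a : L) (r : seq L) (x : L) :
  minPoly 1 a = \prod_(b <- r) ('X - b%:P) -> x \in <<1 & r>>%VS ->
  galois_closure (iota a) (iota x).
Proof.
move=> Dr xK F [F1 FB FM FV] Fconj.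
have F0 : F 0 by rewrite -(subrr 1); apply: FB.
have FD u v : F u -> F v -> F (u + v).
  by move=> Fu Fv; rewrite -[v]opprK -[- v]sub0r; apply: (FB _ _ Fu); apply: FB.
have Fnat n : F n%:R by elim: n => // n IHn; rewrite -natr1; apply: FD.
have Fint z : F z%:~R.
  case: z => n; first exact: Fnat.
  by rewrite NegzE mulrNz -sub0r; apply: FB => //; apply: Fnat.
have Fr b : b \in r -> F (iota b).
  rewrite -root_prod_XsubC -Dr -(fmorph_root iota) -minCpoly_minPoly.
  by case/minCpoly_int_minpoly_root => P [mP rP]; apply: Fconj mP rP.
have {xK}: x \in <<1%AS & r>>%VS by [].
elim/last_ind: r x {Dr} Fr => [|r b IHr] x Fr.
  rewrite Fadjoin_nil => /vlineP[q ->]; rewrite alg_num_field fmorph_rat.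
  by rewrite /ratr; apply: FM => //; apply: FV.
rewrite adjoin_rcons => /Fadjoin_polyP[p /polyOverP pK ->].
rewrite -horner_map /= horner_coef.
apply: (big_ind F) => // i _; apply: (FM).
  rewrite coef_map; apply: IHr => [c rc|]; last exact: pK.
  by apply: Fr; rewrite mem_rcons inE rc orbT.
elim: (nat_of_ord i) => [|n IHn]; first by rewrite expr0.
by rewrite exprS; apply: FM => //; apply: Fr; rewrite mem_rcons mem_head.
Qed.

(** * Classes modulo torsion *)

Lemma minPoly_root_eq (F : fieldType) (L : fieldExtType F) (K : {subfield L}) a b :
  root (minPoly K a) b -> minPoly K b = minPoly K a.
Proof.
move=> rb; apply/eqP; rewrite -eqp_monic ?monic_minPoly //.
have dv : minPoly K b %| minPoly K a by apply: minPoly_dvdp rb; apply: minPolyOver.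
have /orP[//|] := minPoly_irr (minPolyOver K b) dv.
rewrite -size_poly_eq1 size_minPoly eqSS adjoin_degreeE gtn_eqF //.
by rewrite divn_gt0 ?adim_gt0 ?dimvS ?subv_adjoin.
Qed.

Lemma torsion1 : torsion 1.
Proof. by exists 1%N. Qed.

Lemma torsionV z : torsion z -> torsion z^-1.
Proof. by case=> n [n0 zn]; exists n; rewrite exprVn zn invr1. Qed.

Lemma torsionM y z : torsion y -> torsion z -> torsion (y * z).
Proof.
case=> m [m0 ym] [n [n0 zn]]; exists (m * n)%N; split; first by rewrite muln_gt0 m0.
by rewrite exprMn exprM ym expr1n mul1r mulnC exprM zn expr1n.
Qed.

Lemma same_class_refl x : x != 0 -> same_class x x.
Proof. by move=> x0; split=> //; split=> //; rewrite divff //; apply: torsion1. Qed.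

Lemma same_class_sym x y : same_class x y -> same_class y x.
Proof. by case=> x0 [y0 /torsionV t]; split=> //; split=> //; rewrite invf_div in t. Qed.

Lemma same_class_trans x y z : same_class x y -> same_class y z -> same_class x z.
Proof.
case=> x0 [y0 t] [_ [z0 u]]; split=> //; split=> //.
by have := torsionM t u; rewrite mulrA divfK.
Qed.

(** Some [k > 0] has [x ^+ k = y ^+ k]; apply [mahler_exp] on both sides. This is constancy of the
    height on a class, with exponents cleared. *)
Lemma same_class_mahler x y : same_class x y ->
  mahler x ^+ algC_degree y = mahler y ^+ algC_degree x.
Proof.
case=> _ [y0 [k [k0]]]; rewrite expr_div_n => /(canRL (divfK _)).
rewrite expf_neq0 // mul1r => /(_ isT) Exy.
have Hx := mahler_exp x k0; have Hy := mahler_exp y k0; rewrite Exy in Hx.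
apply: (@pexpIrn _ (k * algC_degree (y ^+ k))).
- by rewrite muln_gt0 k0 algC_degree_gt0.
- by rewrite nnegrE exprn_ge0 ?mahler_ge0.
- by rewrite nnegrE exprn_ge0 ?mahler_ge0.
by rewrite -!exprM ![(algC_degree _ * (k * _))%N]mulnC !exprM -!(exprM _ k) -Hx -Hy -!exprM mulnC.
Qed.

Lemma mahler_le_of_same_class x y : same_class x y ->
  (algC_degree x <= algC_degree y)%N -> mahler x <= mahler y.
Proof.
move=> /same_class_mahler E le_d.
rewrite -(ler_pXn2r (algC_degree_gt0 x)) ?nnegrE ?mahler_ge0 // -E.
by apply: ler_weXn2l => //; apply: mahler_ge1.
Qed.

Lemma min_degree_in_class a : a != 0 -> exists2 g, same_class g a &
  forall g', same_class g' a -> (algC_degree g <= algC_degree g')%N.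
Proof.
move=> /same_class_refl; have: exists n, (algC_degree a < n)%N by exists (algC_degree a).+1.
case=> n; move: {1 2}a => g; elim: n g => // n IHn g le_gn ga.
have [[g' [g'a lt]]|H] := excluded_middle_informative
  (exists g', same_class g' a /\ (algC_degree g' < algC_degree g)%N).
  by apply: IHn g'a; apply: leq_trans lt le_gn.
exists g => // g' g'a; rewrite leqNgt; apply/negP => lt; apply: H; by exists g'.
Qed.

(** A representative of least degree minimizes [mahler] on its class, so the infimum exists and the
    [epsilon] in [Mbar] returns it. *)
Lemma Mbar_attained a : a != 0 -> exists g,
  [/\ same_class g a, Mbar a = mahler g &
      forall b, same_class b a -> Mbar a <= mahler b].
Proof.
case/min_degree_in_class => g ga min_g.
have le_g b : same_class b a -> mahler g <= mahler b.
  move=> ba; apply: mahler_le_of_same_class (min_g _ ba).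
  exact: same_class_trans ga (same_class_sym ba).
have Hinf : is_inf (fun m => exists b', same_class b' a /\ m = mahler b') (mahler g).
  by split=> [_ [b [ba ->]] | l]; [apply: le_g | apply; exists g].
have [lb glb] := epsilon_spec (inhabits 0) _ (ex_intro _ _ Hinf).
exists g; have -> : Mbar a = mahler g.
  apply/le_anti/andP; split; first by apply: lb; exists g.
  by apply: glb => x; apply: (proj1 Hinf).
by split.
Qed.

Lemma Mbar_le b : b != 0 -> Mbar b <= mahler b.
Proof.
by move=> b0; have [g [_ _]] := Mbar_attained b0; apply; apply: same_class_refl.
Qed.

(** * Norms and roots of products of conjugates *)

Lemma gal_image_prod (L : splittingFieldType rat) (K : {subfield L}) y (r : seq L) :
  minPoly K y = \prod_(b <- r) ('X - b%:P) ->
  galNorm K {:L} y = (\prod_(b <- r) b) ^+ #|'Gal({:L} / <<K; y>>)%G|.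
Proof.
move=> Dr; have [t [Dt Pt]] := gal_orbit K y.
have Prt : perm_eq r t by apply: prod_XsubC_eq; rewrite -Dr.
rewrite /galNorm -big_enum /= -(big_map _ xpredT id) (perm_big _ Pt) /= (perm_big _ Prt).
by elim: #|_| => [|k IHk] /=; rewrite ?big_nil ?expr0 // big_cat /= IHk exprS.
Qed.

(** Write [h] for the height and [d] for [size r]. Then [h(beta)^d = h(eta) <= h(y)^d], while
    [deg beta <= d * deg eta <= deg y]; together these bound the measure. *)
Lemma conj_prod_root_mahler_le (L : splittingFieldType rat) (iota : {rmorphism L -> algC})
    (K : {subfield L}) y (r : seq L) (beta : algC) :
  normalField 1 K -> minPoly K y = \prod_(b <- r) ('X - b%:P) ->
  beta ^+ size r = iota (\prod_(b <- r) b) -> mahler beta <= mahler (iota y).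
Proof.
move=> nK Dr Dbeta; set eta := \prod_(b <- r) b in Dbeta.
have d0 : (0 < size r)%N.
  rewrite -ltnS -(size_prod_XsubC r id) -Dr size_minPoly ltnS adjoin_degreeE.
  by rewrite divn_gt0 ?adim_gt0 ?dimvS ?subv_adjoin.
have degE z : (size (minPoly 1 z)).-1 = algC_degree (iota z).
  by rewrite /algC_degree minCpoly_minPoly size_map_poly.
have := degree_conj_prod nK Dr; rewrite !degE -/eta => le_de.
have conj_r : {in r, forall b, minCpoly (iota b) = minCpoly (iota y)}.
  move=> b rb; rewrite !minCpoly_minPoly; congr map_poly; apply: minPoly_root_eq.
  rewrite -dvdp_XsubCl; apply: dvdp_trans (minPolyS _ (sub1v K)).
  by rewrite dvdp_XsubCl Dr root_prod_XsubC.
have Aeta := mahler_gal_prod_le conj_r; rewrite -/eta in Aeta.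
have Ge := card_gal_degree iota eta; have Gy := card_gal_degree iota y.
have Dexp := mahler_exp beta d0; rewrite Dbeta in Dexp.
have le_b := algC_degree_root_le beta d0; rewrite Dbeta in le_b.
move: Aeta Ge Gy Dexp le_b le_de.
move: (mahler_ge0 beta) (mahler_ge0 (iota eta)) (mahler_ge1 (iota y)).
move: (algC_degree_gt0 beta) (algC_degree_gt0 (iota eta)) (algC_degree_gt0 (iota y)).
set b := algC_degree beta; set e := algC_degree (iota eta); set c := algC_degree (iota y).
set s := #|'Gal({:L} / <<_; eta>>)%G|; set t := #|'Gal({:L} / <<_; y>>)%G|.
have := cardG_gt0 'Gal({:L} / 1%AS)%G; set g := #|_|.
set d := size r in d0 *.
move: (mahler beta) (mahler (iota eta)) (mahler (iota y)) => B E Y.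
move: d b e c s t g d0 => d b e c s t g d0 g0 b0 e0 c0 B0 E0 Y1 HA Ge Gy HD le_b le_de.
have Y0 := le_trans ler01 Y1.
(* Here [B], [E], [Y] are the measures and [b], [e], [c] the degrees of [beta], [eta], [y]. The
   claim is [h(eta) <= h(y)^d] with exponents cleared. *)
have le_EY : E ^+ c <= Y ^+ (d * e).
  rewrite -(ler_pXn2r g0) ?nnegrE ?exprn_ge0 // -!exprM.
  have -> : (c * g = s * (e * c))%N by rewrite Ge mulnC mulnA.
  have -> : (d * e * g = t * d * (e * c))%N by rewrite Gy mulnACA [(d * t)%N]mulnC.
  by rewrite [E ^+ _]exprM [Y ^+ _]exprM; apply: lerXn2r; rewrite ?nnegrE ?exprn_ge0.
(* Go through [B ^+ c <= Y ^+ b <= Y ^+ c]: first the comparison of heights, then that of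
   degrees. *)
rewrite -(ler_pXn2r c0) ?nnegrE //; apply: le_trans (_ : Y ^+ b <= _); last first.
  by apply: ler_weXn2l => //; apply: leq_trans le_b le_de.
have de0 : (0 < d * e)%N by rewrite muln_gt0 d0.
rewrite -(ler_pXn2r de0) ?nnegrE ?exprn_ge0 // -!exprM.
rewrite mulnC exprM -HD -exprM mulnC exprM [(b * _)%N]mulnC [Y ^+ _]exprM.
by apply: lerXn2r; rewrite ?nnegrE ?exprn_ge0.
Qed.

Lemma exists_choice_fun (I T : Type) (P : I -> T -> Prop) :
  (forall i, exists x, P i x) -> exists f, forall i, P i (f i).
Proof.
move=> H; exists (fun i => proj1_sig (constructive_indefinite_description _ (H i))) => i.
by case: constructive_indefinite_description.
Qed.

(** * The new factorization, with factors from the Galois closure *)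

Theorem mainTheorem7 (alpha : algC) (N : nat) (a : 'I_N -> algC) :
  alpha != 0 ->
  (forall n, a n != 0) ->
  same_class alpha (\prod_(n < N) a n) ->
  exists b : 'I_N -> algC,
    (forall n, b n != 0) /\
    same_class alpha (\prod_(n < N) b n) /\
    (forall n, in_S (galois_closure alpha) (b n) /\ Mbar (b n) <= Mbar (a n)).
Proof.
move=> alpha0 a0 alphaE.
pose minimal n x := same_class x (a n) /\ Mbar (a n) = mahler x.
have [g Hg] : exists g : 'I_N -> algC, forall n, minimal n (g n).
  by apply: exists_choice_fun => n; have [g [? ? _]] := Mbar_attained (a0 n); exists g.
have g0 n : g n != 0 by have [[]] := Hg n.
(* Passing to representatives of least measure changes the product only by a root of unity. *)
have torsion_g : torsion (alpha / \prod_(n < N) g n).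
  case: alphaE => _ [_ t].
  have u : torsion (\prod_(n < N) a n / \prod_(n < N) g n).
    rewrite -prodf_div; apply: (big_ind torsion); [exact: torsion1 | exact: torsionM | move=> n _].
    by have [/same_class_sym[_ []]] := Hg n.
  have := torsionM t u; rewrite mulrA divfK //; apply/prodf_neq0 => n _; exact: a0.
have [L [iota HL]] := splitting_num_field (alpha :: codom g).
have [al Dal] := HL alpha (mem_head _ _).
have [y Dy] : exists y : 'I_N -> L, forall n, iota (y n) = g n.
  apply: (exists_choice_fun (P := fun n x => iota x = g n)) => n.
  by apply: HL; rewrite inE codom_f orbT.
have [ra [Dra _]] := gal_orbit 1%AS al.
pose K : {subfield L} := <<1%AS & ra>>%AS.
have nK : normalField 1 K.
  apply/splitting_normalField; first exact: sub1v.
  exists (minPoly 1 al); first exact: minPolyOver.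
  by exists ra; rewrite ?Dra ?eqpxx.
have alK : al \in K by apply: seqv_sub_adjoin; rewrite -root_prod_XsubC -Dra root_minPoly.
pose H := 'Gal({:L} / K)%G.
(* The root taken has order [size r], which varies with [n]. Raising to the common exponent [#|H|]
   gives the norm in every case, so the factors can be multiplied. *)
have Hb n : exists b, [/\ b != 0, b ^+ #|H| = iota (galNorm K {:L} (y n)),
    in_S (galois_closure alpha) b & mahler b <= mahler (g n)].
  have [r [Dr _]] := gal_orbit K (y n).
  have y0 : y n != 0 by rewrite -(fmorph_eq0 iota) Dy.
  have DH : #|H| = (#|'Gal({:L} / <<K; y n>>)%G| * size r)%N.
    by rewrite (card_gal_adjoin K (y n)) Dr size_prod_XsubC.
  have d0 : (0 < size r)%N by have := cardG_gt0 H; rewrite DH muln_gt0 => /andP[].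
  pose b := (size r).-root (iota (\prod_(x <- r) x)).
  have Db : b ^+ size r = iota (\prod_(x <- r) x) by rewrite rootCK.
  have bH : b ^+ #|H| = iota (galNorm K {:L} (y n)).
    by rewrite DH mulnC exprM Db (gal_image_prod Dr) rmorphXn.
  have b0 : b != 0.
    have: b ^+ #|H| != 0 by rewrite bH fmorph_eq0 galNorm_eq0.
    by rewrite expf_eq0 cardG_gt0.
  exists b; split=> //; last first.
    by rewrite -Dy; apply: conj_prod_root_mahler_le nK Dr Db.
  exists b; split; last exact: same_class_refl.
  split=> //; exists (size r); split=> //; rewrite Db -Dal.
  exact: galois_closure_adjoin Dra (prod_conj_mem Dr).
have {Hb} [b Hb] := exists_choice_fun Hb.
have b0 n : b n != 0 by have [] := Hb n.
exists b; split=> //; split; last first.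
  move=> n; have [_ _ ? le_bg] := Hb n; split=> //.
  by have [_ ->] := Hg n; apply: le_trans (Mbar_le (b0 n)) le_bg.
split=> //; split; first by apply/prodf_neq0 => n _.
(* As [al] lies in [K], its norm is [al ^+ #|H|], so the [#|H|]-th power of the new quotient is the
   norm of [z]. Since [z ^+ k = 1], a further [k]-th power gives 1. *)
case: torsion_g => k [k0 zk]; exists (#|H| * k)%N; split; first by rewrite muln_gt0 cardG_gt0.
pose z := al / \prod_(n < N) y n.
have Dz : iota z = alpha / \prod_(n < N) g n.
  by rewrite fmorph_div Dal rmorph_prod; congr (_ / _); apply: eq_bigr.
have zk1 : z ^+ k = 1 by apply: (fmorph_inj iota); rewrite rmorphXn rmorph1 Dz.
have Nz : iota (galNorm K {:L} z) = (alpha / \prod_(n < N) b n) ^+ #|H|.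
  have -> : (alpha / \prod_(n < N) b n) ^+ #|H| =
    alpha ^+ #|H| / iota (galNorm K {:L} (\prod_(n < N) y n)).
    rewrite expr_div_n galNorm_prod rmorph_prod -prodrXl; congr (_ / _).
    by apply: eq_bigr => n _; have [_ ->] := Hb n.
  rewrite galNormM galNormV fmorph_div; congr (_ / _).
  rewrite -Dal -rmorphXn; congr (iota _); rewrite -prodr_const; apply: eq_bigr => s Hs.
  exact: fixed_gal (subvf K) Hs alK.
by rewrite exprM -Nz -rmorphXn -galNormX zk1 galNorm1 rmorph1.
Qed.
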